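(* Let $K$ be a countable algebraically closed field, let $Q$ be the quiver with vertex set $\omega$ and arrows $a_n:n+1\to n$ ($n\in\omega$), and let $M_{\omega_1}$ be the $KQ$-module defined in the context. Then $\mathsf{UP}$ implies $\mathrm{Ext}^1_{KQ}(M_{\omega_1},KQ)=0$. In particular, under $\mathsf{UP}$ it is not true that every $KQ$-module $M$ with $\mathrm{Ext}^n_{KQ}(M,KQ)=0$ for all $n\ge1$ is projective.
   Context: Paths in a quiver are composable sequences of arrows written left to right, with trivial paths $e_v$; the path algebra $KQ$ has basis all paths, product = concatenation when the target of the first equals the source of the second, else $0$. Modules are right modules; projective means every epimorphism onto it splits. $\omega_1$ is the first uncountable ordinal, $\mathrm{Lim}$ the class of nonzero limit ordinals. Fix a ladder system: for each $\alpha\in\omega_1\cap\mathrm{Lim}$ a set $C_\alpha=\{\zeta^\alpha_n:n\in\omega\}$, strictly increasingly enumerated and cofinal in $\alpha$, such that each $\zeta^\alpha_n$ equals $\delta+n+1$ for some $\delta\in\alpha\cap(\{0\}\cup\mathrm{Lim})$. For $\gamma\in\omega_1\setminus(\{0\}\cup\mathrm{Lim})$ let $n_\gamma\in\omega$ be the unique integer with $\gamma=\delta+n_\gamma+1$ for some $\delta\in\{0\}\cup\mathrm{Lim}$. For $\xi<\omega_1$ let $F^\xi=KQ$ if $\xi\notin\mathrm{Lim}$ and $F^\xi=\bigoplus_{n\in\omega}KQ$ if $\xi\in\mathrm{Lim}$; let $F=\bigoplus_{\xi<\omega_1}F^\xi$ (finite-support functions, coordinatewise operations). For $\gamma\notin\mathrm{Lim}$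 and a vertex $m$, $e^\gamma_m\in F$ has support $\{\gamma\}$ and value $e_m$ there; for $\alpha\in\mathrm{Lim}$ and vertex $m$, $e^\alpha_m\in F$ has support $\{\alpha\}$ and value at $\alpha$ the element of $\bigoplus_{n}KQ$ with support $\{0\}$ and value $e_m$. Let $G_\alpha$ be the $KQ$-submodule of $F$ generated by $\{e^{\zeta^\alpha_n}_n-e^\alpha_n+e^\alpha_{n+1}a_n:n\in\omega\}$, let $I=\sum_{\alpha\in\omega_1\cap\mathrm{Lim}}G_\alpha$, and let $M_{\omega_1}$ be the $KQ$-submodule of $F/I$ generated by $\{e^\gamma_{n_\gamma}+I:\gamma\in\omega_1\setminus(\{0\}\cup\mathrm{Lim})\}\cup\{e^\alpha_n+I:\alpha\in\omega_1\cap\mathrm{Lim},n\in\omega\}$. $\mathsf{UP}$: for any sequence $\langle X_\beta:\beta<\omega_1\rangle$ of countable sets and any ladder system $\langle C_\alpha\rangle$ (each $C_\alpha=\{\zeta^\alpha_n\}$ cofinal in $\alpha$ of order type $\omega$) with functions $d_\alpha$ on $C_\alpha$ satisfying $d_\alpha(\zeta^\alpha_n)\in X_{\zeta^\alpha_n}$, there is a function $f$ on $\omega_1$ such that for each $\alpha$, $f(\zeta^\alpha_n)=d_\alpha(\zeta^\alpha_n)$ for all but finitely many $n$. *)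

(* Defs.v *)
From HB Require Import structures.
From mathcomp Require Import all_boot all_order all_algebra.
From mathcomp Require Import finmap.
From mathcomp.multinomials Require Import monalg.
From Stdlib Require Import ClassicalEpsilon.

Set Implicit Arguments.
Unset Strict Implicit.
Unset Printing Implicit Defensive.

Import Order.TTheory GRing.Theory.
Local Open Scope ring_scope.

(* Q : vertices nat, arrows a_n : n+1 -> n.  A path is determined by   *)
(* its target t and its length l; it is a_{t+l-1} ... a_t (written left *)
(* to right), from source t+l to target t; length 0 gives e_t.        *)
Definition path := (nat * nat)%type.
Definition ptgt (p : path) : nat := p.1.
Definition psrc (p : path) : nat := (p.1 + p.2)%N.
Definition triv (v : nat) : path := (v, 0%N).
Definition arrow (n : nat) : path := (n, 1%N).
(* concatenation p q (p first, then q), meaningful when ptgt p = psrc q *)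
Definition pcat (p q : path) : path := (q.1, (p.2 + q.2)%N).

Section PathAlgebra.
Variable K : fieldType.

Definition KQ := {malg K[path]}.

Definition KQmul (x y : KQ) : KQ :=
  \sum_(p <- msupp x) \sum_(q <- msupp y)
     (x@_p * y@_q) *: (if ptgt p == psrc q then << pcat p q >> else 0).

Record rmodule := RModule {
  mcar :> Type;
  mzero : mcar;
  madd : mcar -> mcar -> mcar;
  mopp : mcar -> mcar;
  mact : mcar -> KQ -> mcar }.

(* Module axioms; modules over the ring with enough idempotents KQ are  *)
(* unital: M = M.KQ, i.e. every m satisfies m = m.r for some r.        *)
Definition is_rmodule (M : rmodule) : Prop :=
  (forall a b c : M, madd a (madd b c) = madd (madd a b) c) /\
  (forall a b : M, madd a b = madd b a) /\
  (forall a : M, madd (mzero M) a = a) /\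
  (forall a : M, madd (mopp a) a = mzero M) /\
  (forall (a b : M) r, mact (madd a b) r = madd (mact a r) (mact b r)) /\
  (forall (a : M) r s, mact a (r + s) = madd (mact a r) (mact a s)) /\
  (forall (a : M) r s, mact (mact a r) s = mact a (KQmul r s)) /\
  (forall a : M, exists r, mact a r = a).

Definition is_hom (M N : rmodule) (f : M -> N) : Prop :=
  (forall a b : M, f (madd a b) = madd (f a) (f b)) /\
  (forall (a : M) r, f (mact a r) = mact (f a) r).

Definition projective (P : rmodule) : Prop :=
  forall (E : rmodule) (p : E -> P), is_rmodule E -> is_hom p ->
    (forall x : P, exists e, p e = x) ->
    exists s : P -> E, is_hom s /\ (forall x, p (s x) = x).

Definition proj_resolution (M : rmodule) (P : nat -> rmodule)
  (d : forall k, P k.+1 -> P k) (eps : P 0%N -> M) : Prop :=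
  (forall k, is_rmodule (P k)) /\ (forall k, projective (P k)) /\
  (forall k, is_hom (d k)) /\ is_hom eps /\
  (forall x : M, exists y, eps y = x) /\
  (forall x, eps x = mzero M <-> exists y, x = d 0%N y) /\
  (forall k x, d k x = mzero (P k) <-> exists y, x = d k.+1 y).

(* Ext^n(M,N) = 0, computed as the n-th cohomology of Hom(P_*, N) for a *)
(* projective resolution P_* of M (any resolution; the value does not   *)
(* depend on the choice).                                              *)
Definition Ext_zero (n : nat) (M N : rmodule) : Prop :=
  forall (P : nat -> rmodule) (d : forall k, P k.+1 -> P k) (eps : P 0%N -> M),
    @proj_resolution M P d eps ->
    match n with
    | 0%N => forall f : P 0%N -> N, is_hom f ->
               (forall x, f (d 0%N x) = mzero N) -> forall x, f x = mzero N
    | m.+1 => forall f : P m.+1 -> N, is_hom f ->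
               (forall x, f (d m.+1 x) = mzero N) ->
               exists g : P m -> N, is_hom g /\ (forall x, f x = g (d m x))
    end.

Definition KQreg : rmodule := @RModule KQ 0 +%R -%R KQmul.

Definition gen (M : rmodule) (S : M -> Prop) (x : M) : Prop :=
  forall P : M -> Prop, (forall y, S y -> P y) -> P (mzero M) ->
    (forall a b, P a -> P b -> P (madd a b)) -> (forall a, P a -> P (mopp a)) ->
    (forall a r, P a -> P (mact a r)) -> P x.

Lemma gen0 M S : @gen M S (mzero M).
Proof. by move=> P _ H0 *. Qed.
Lemma genD M S a b : @gen M S a -> gen S b -> gen S (madd a b).
Proof. move=> Ha Hb P HS H0 HD HN HA; exact: (HD _ _ (Ha P HS H0 HD HN HA) (Hb P HS H0 HD HN HA)). Qed.
Lemma genN M S a : @gen M S a -> gen S (mopp a).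
Proof. move=> Ha P HS H0 HD HN HA; exact: (HN _ (Ha P HS H0 HD HN HA)). Qed.
Lemma genA M S a r : @gen M S a -> gen S (mact a r).
Proof. move=> Ha P HS H0 HD HN HA; exact: (HA _ r (Ha P HS H0 HD HN HA)). Qed.

Definition subgen (M : rmodule) (S : M -> Prop) : rmodule :=
  @RModule {x : M | gen S x} (exist _ (mzero M) (@gen0 M S))
    (fun a b => exist _ (madd (sval a) (sval b)) (genD (svalP a) (svalP b)))
    (fun a => exist _ (mopp (sval a)) (genN (svalP a)))
    (fun a r => exist _ (mact (sval a) r) (genA r (svalP a))).

Definition coset (M : rmodule) (I : M -> Prop) (x : M) : M -> Prop :=
  fun y => I (madd y (mopp x)).
Definition qcar (M : rmodule) (I : M -> Prop) :=
  {A : M -> Prop | exists x, A = coset I x}.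
Definition qcls (M : rmodule) (I : M -> Prop) (x : M) : qcar I :=
  exist _ (coset I x) (ex_intro _ x erefl).
Definition qrep (M : rmodule) (I : M -> Prop) (A : qcar I) : M :=
  proj1_sig (constructive_indefinite_description _ (proj2_sig A)).
Definition quot (M : rmodule) (I : M -> Prop) : rmodule :=
  @RModule (qcar I) (qcls I (mzero M))
    (fun A B => qcls I (madd (qrep A) (qrep B)))
    (fun A => qcls I (mopp (qrep A)))
    (fun A r => qcls I (mact (qrep A) r)).

End PathAlgebra.

Section Omega1.
Local Open Scope order_scope.
Context {disp : Order.disp_t} {W : orderType disp}.

Definition is_omega1 : Prop :=
  [/\ (forall S : W -> Prop, (exists x, S x) ->
         exists x, S x /\ forall y, S y -> x <= y),
      ~ (exists f : W -> nat, injective f) &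
      (forall a : W, exists f : W -> nat,
         forall x y, x < a -> y < a -> f x = f y -> x = y)].

Definition is_zero (a : W) : Prop := forall b, a <= b.
Definition is_succ (b a : W) : Prop := b < a /\ forall c, b < c -> a <= c.
Definition is_limit (a : W) : Prop := ~ is_zero a /\ ~ exists b, is_succ b a.
Definition limitb (a : W) : bool :=
  if excluded_middle_informative (is_limit a) then true else false.

Fixpoint plus_nat (d : W) (n : nat) (g : W) : Prop :=
  match n with
  | 0%N => g = d
  | m.+1 => exists b, plus_nat d m b /\ is_succ b g
  end.

Definition ladder (zeta : W -> nat -> W) : Prop :=
  forall a, is_limit a ->
    [/\ (forall n, zeta a n < zeta a n.+1),
        (forall n, zeta a n < a) &
        (forall b, b < a -> exists n, b < zeta a n)].

Definition special_ladder (zeta : W -> nat -> W) : Prop :=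
  ladder zeta /\
  forall a, is_limit a -> forall n, exists d, d < a /\
     (is_zero d \/ is_limit d) /\ plus_nat d n.+1 (zeta a n).

Definition countable_set (T : Type) (X : T -> Prop) : Prop :=
  exists f : T -> nat, forall x y, X x -> X y -> f x = f y -> x = y.

Definition UP : Prop :=
  forall (T : Type) (X : W -> T -> Prop) (zeta : W -> nat -> W)
         (dd : W -> nat -> T),
    (forall b, countable_set (X b)) -> ladder zeta ->
    (forall a n, is_limit a -> X (zeta a n) (dd a n)) ->
    exists f : W -> T, forall a, is_limit a ->
      exists N, forall n, (N <= n)%N -> f (zeta a n) = dd a n.

End Omega1.

Section Momega.
Variables (K : fieldType) (disp : Order.disp_t) (W : orderType disp).
Variable zeta : W -> nat -> W.

(* index of the summands: (xi, c) with c = 0 unless xi is a limit      *)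
Definition Fidx := {j : W * nat | limitb j.1 || (j.2 == 0%N)}.
(* F = (+)_{xi < omega_1} F^xi, F^xi = KQ or (+)_n KQ                  *)
Definition Fcar := {malg K[(Fidx * path)%type]}.

Definition Fact (x : Fcar) (r : KQ K) : Fcar :=
  \sum_(k <- msupp x) \sum_(q <- msupp r)
     (x@_k * r@_q) *: (if ptgt k.2 == psrc q then << (k.1, pcat k.2 q) >> else 0).

Definition Fmod : rmodule K := @RModule K Fcar 0 +%R -%R Fact.

(* e^xi_m : support {xi}, value e_m (in copy 0 when xi is a limit) *)
Definition ebase (xi : W) (m : nat) : Fcar :=
  << (exist (fun j : W * nat => limitb j.1 || (j.2 == 0%N)) (xi, 0%N)
        (orbT (limitb xi)), triv m) >>.

Definition Ggen (a : W) (n : nat) : Fcar :=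
  ebase (zeta a n) n - ebase a n + Fact (ebase a n.+1) << arrow n >>.

(* I = sum_alpha G_alpha = submodule generated by all generators *)
Definition Isub : mcar Fmod -> Prop :=
  @gen K Fmod (fun x => exists a n, is_limit a /\ x = Ggen a n).

Definition FmodI : rmodule K := @quot K Fmod Isub.

Definition Mgens (c : FmodI) : Prop :=
  (exists g n, (exists d, (is_zero d \/ is_limit d) /\ plus_nat d n.+1 g) /\
     c = @qcls K Fmod Isub (ebase g n)) \/
  (exists a n, is_limit a /\ c = @qcls K Fmod Isub (ebase a n)).

Definition Momega1 : rmodule K := @subgen K FmodI Mgens.

End Momega.

(* Main.v *)
From HB Require Import structures.
From mathcomp Require Import all_boot all_order all_algebra.
From mathcomp Require Import finmap.
From mathcomp.multinomials Require Import monalg.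
From mathcomp Require boolp.
From Stdlib Require Import ClassicalEpsilon.
Require Import Defs.

(** Write [F] for the free module of the construction. There is a complex
    [psi : F -> F], [pi : F -> M_omega1] with [ker pi = im psi] and [F]
    projective, in which [psi] sends the [n]-th generator at a limit [alpha] to
    the [n]-th generator of [G_alpha]; [psi] has a linear left inverse (up to an
    idempotent), so that [M_omega1] has projective dimension at most one and
    [Ext^n] vanishes for [n >= 2].  A homomorphism [h] on the relations extends
    to [F] iff the equations [Y_n = X_{zeta_n} - h_n + Y_{n+1} a_n] are
    solvable for every [alpha]; if [X] uniformizes the [h_n], then
    [X_{zeta_n} = h_n] for large [n], one takes [Y_n = 0] there and solves
    downwards.

    [M_omega1] is not projective: a section [s] of [pi] maps the part below
    some limit [delta] into the part of [F] below [delta].  Modulo that part,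
    the image of the generator [e^delta_0] is divisible by paths of every
    length, hence zero.  But [e^delta_0] does not lie in the submodule of
    [M_omega1] generated below [delta], as the sum of the coefficients at [delta]
    shows. *)

Set Implicit Arguments.
Unset Strict Implicit.
Unset Printing Implicit Defensive.

Import Order.TTheory GRing.Theory.
Local Open Scope ring_scope.

(** * Additive extension of maps from basis elements *)

Section MalgExtension.
Variables (K : fieldType) (T : choiceType).

Lemma malg_ind (P : {malg K[T]} -> Prop) :
  (forall c k, P << c *g k >>) -> (forall x y, P x -> P y -> P (x + y)) ->
  P 0 -> forall x, P x.
Proof.
move=> PU PD P0 x; rewrite [x]monalgE.
exact: big_ind.
Qed.

Lemma scale_malgU (c d : K) (k : T) :
  c *: << d *g k >> = << c * d *g k >> :> {malg K[T]}.
Proof.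
by apply/malgP => k'; rewrite mcoeffZ !mcoeffU -mulrnAr.
Qed.

Lemma malgUE (c : K) (k : T) : << c *g k >> = c *: << k >> :> {malg K[T]}.
Proof. by rewrite scale_malgU mulr1. Qed.

Section Additive.
Variables (V : zmodType) (phi : T -> K -> V).
Hypothesis phiD : forall t, {morph phi t : a b / a + b}.

(** The carrier of an [rmodule] has no scalar multiplication by [K], so [phi] takes the coefficient
    together with the basis element and [V] is only an abelian group. *)
Definition mext (x : {malg K[T]}) : V := \sum_(k <- msupp x) phi k x@_k.

Let phi0 t : phi t 0 = 0.
Proof. by apply: (addrI (phi t 0)); rewrite -phiD !addr0. Qed.

Lemma mextEw (d : {fset T}) x :
  (msupp x `<=` d)%fset -> mext x = \sum_(k <- d) phi k x@_k.
Proof.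
move=> le; rewrite /mext (big_fset_incl _ le) //= => k _ kx.
by rewrite mcoeff_outdom.
Qed.

Lemma mextD : {morph mext : x y / x + y}.
Proof.
move=> x y; pose d := (msupp x `|` msupp y)%fset.
rewrite (@mextEw d (x + y)) ?msuppD_le // (@mextEw d x) ?fsubsetUl //.
rewrite (@mextEw d y) ?fsubsetUr // -big_split /=.
by apply: eq_bigr => k _; rewrite mcoeffD phiD.
Qed.

Lemma mextU c k : mext << c *g k >> = phi k c.
Proof.
by rewrite (@mextEw [fset k]%fset) ?msuppU_le // big_seq_fset1 mcoeffUU.
Qed.

End Additive.

Section Linear.
Variables (V : lmodType K) (phi : T -> V).

Definition lext (x : {malg K[T]}) : V := mext (fun k c => c *: phi k) x.

Let phiD t : {morph (fun c => c *: phi t) : a b / a + b}.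
Proof. by move=> a b /=; rewrite scalerDl. Qed.

Lemma lextD : {morph lext : x y / x + y}.
Proof. exact: mextD. Qed.

Lemma lextU c k : lext << c *g k >> = c *: phi k.
Proof. exact: mextU. Qed.

Lemma lext0 : lext 0 = 0.
Proof. by apply: (addrI (lext 0)); rewrite -lextD !addr0. Qed.

Lemma lextN : {morph lext : x / - x}.
Proof.
by move=> x; apply: (addrI (lext x)); rewrite -lextD !subrr lext0.
Qed.

End Linear.
End MalgExtension.

(** * The action of paths on formal combinations *)

Section PathAction.
Variables (K : fieldType) (X : choiceType) (tgt : X -> nat) (cat : X -> path -> X).
Hypothesis cat_triv : forall x, cat x (triv (tgt x)) = x.

Definition pact_basis (k : X) (q : path) : {malg K[X]} :=
  if tgt k == psrc q then << cat k q >> else 0.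

(** By conversion, [X := path] gives [KQmul] and [X := I * path] the action on a free module. *)
Definition pact (x : {malg K[X]}) (r : KQ K) : {malg K[X]} :=
  \sum_(k <- msupp x) \sum_(q <- msupp r) (x@_k * r@_q) *: pact_basis k q.

Lemma pactE x r : pact x r = lext (fun k => lext (pact_basis k) r) x.
Proof.
rewrite /lext /mext; apply: eq_bigr => k _; rewrite scaler_sumr.
by apply: eq_bigr => q _; rewrite scalerA.
Qed.

Lemma pactDl x y r : pact (x + y) r = pact x r + pact y r.
Proof. by rewrite !pactE lextD. Qed.

Lemma pactDr x r s : pact x (r + s) = pact x r + pact x s.
Proof.
rewrite !pactE; elim/malg_ind: x => [c k|x y IHx IHy|].
- by rewrite !lextU lextD scalerDr.
- by rewrite !(lextD _ x y) IHx IHy; exact: addrACA.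
- by rewrite !lext0 addr0.
Qed.

Lemma pactUU c k d q :
  pact << c *g k >> << d *g q >> = (c * d) *: pact_basis k q.
Proof. by rewrite pactE !lextU scalerA. Qed.

Lemma pact0l r : pact 0 r = 0.
Proof. by rewrite pactE lext0. Qed.

Lemma pact0r x : pact x 0 = 0.
Proof. by apply: (addrI (pact x 0)); rewrite -pactDr !addr0. Qed.

Lemma pactNl x r : pact (- x) r = - pact x r.
Proof. by rewrite !pactE lextN. Qed.

Lemma pactUUcat c k d q : tgt k = psrc q ->
  pact << c *g k >> << d *g q >> = << c * d *g cat k q >>.
Proof. by move=> e; rewrite pactUU /pact_basis e eqxx -malgUE. Qed.

Lemma pactUU0 c k d q : tgt k != psrc q ->
  pact << c *g k >> << d *g q >> = 0.
Proof. by move=> /negbTE e; rewrite pactUU /pact_basis e scaler0. Qed.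

Lemma pact_triv c k : pact << c *g k >> << triv (tgt k) >> = << c *g k >>.
Proof. by rewrite pactUUcat ?mulr1 ?cat_triv // /psrc /= addn0. Qed.

(** [KQ] has infinitely many vertices, hence no identity; these are its local units. *)
Definition KQunit (n : nat) : KQ K := \sum_(v < n) << triv v >>.

(** A finite support has finitely many targets. The form with all large [m] lets two elements share
    one unit. *)
Lemma pact_unit x : exists n, forall m, (n <= m)%N -> pact x (KQunit m) = x.
Proof.
elim/malg_ind: x => [c k|x y [n Hn] [m Hm]|].
- exists (tgt k).+1 => m km.
  rewrite (big_morph _ (pactDr _) (pact0r _)) (bigD1 (Ordinal km)) //=.
  rewrite pact_triv big1 ?addr0 // => v vk.
  by rewrite pactUU0 // /psrc /= addn0 eq_sym; apply: contra vk => /eqP e; apply/eqP/val_inj.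
- exists (maxn n m) => l; rewrite geq_max => /andP[nl ml].
  by rewrite pactDl Hn // Hm.
- by exists 0%N => m _; rewrite pact0l.
Qed.
End PathAction.

(** * Modules over the path algebra: lifting, pullbacks, quotients *)

Section Modules.
Variable K : fieldType.

Lemma KQmulE : @KQmul K = pact ptgt pcat.
Proof. by []. Qed.

Lemma psrc_pcat p q : ptgt p = psrc q -> psrc (pcat p q) = psrc p.
Proof. by case: p q => [a b] [c d]; rewrite /psrc /ptgt /= => ->; rewrite addnAC addnA. Qed.

Lemma pcat_triv p : pcat p (triv (ptgt p)) = p.
Proof. by case: p => a b; rewrite /pcat addn0. Qed.

(** By additivity only basis elements matter; there both sides are zero as soon as one of the two
    junctions fails to compose. *)
Lemma pact_assoc (X : choiceType) (tgt : X -> nat) (cat : X -> path -> X) :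
  (forall x q, tgt (cat x q) = ptgt q) ->
  (forall x p q, cat (cat x p) q = cat x (pcat p q)) ->
  forall (x : {malg K[X]}) r s,
  pact tgt cat (pact tgt cat x r) s = pact tgt cat x (KQmul r s).
Proof.
move=> tgt_cat cat_pcat x r s; rewrite KQmulE.
elim/malg_ind: x => [c k|x y IHx IHy|]; last by rewrite !pact0l.
- elim/malg_ind: r => [d p|x y IHx IHy|]; last by rewrite pact0l !pact0r pact0l.
  + elim/malg_ind: s => [e q|x y IHx IHy|]; last by rewrite !pact0r.
    * have [pq|pq] := eqVneq (ptgt p) (psrc q).
        rewrite (pactUUcat _ _ _ pq).
        have [kp|kp] := eqVneq (tgt k) (psrc p).
          rewrite !pactUUcat ?tgt_cat ?mulrA ?cat_pcat //.
          by rewrite psrc_pcat.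
        by rewrite !pactUU0 ?pact0l // psrc_pcat.
      rewrite (pactUU0 _ _ _ pq) pact0r.
      have [kp|kp] := eqVneq (tgt k) (psrc p); last by rewrite pactUU0 // pact0l.
      by rewrite pactUUcat // pactUU0 // tgt_cat.
    * by rewrite !pactDr IHx IHy.
  + by rewrite pactDr !pactDl pactDr IHx IHy.
- by rewrite !pactDl IHx IHy.
Qed.

Lemma pact_is_rmodule (X : choiceType) (tgt : X -> nat) (cat : X -> path -> X) :
  (forall x q, tgt (cat x q) = ptgt q) ->
  (forall x p q, cat (cat x p) q = cat x (pcat p q)) ->
  (forall x, cat x (triv (tgt x)) = x) ->
  is_rmodule (@RModule K {malg K[X]} 0 +%R -%R (pact tgt cat)).
Proof.
move=> H1 H2 H3; do !split => /=.
- exact: addrA.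
- exact: addrC.
- exact: add0r.
- exact: addNr.
- exact: pactDl.
- exact: pactDr.
- exact: pact_assoc.
- by move=> x; have [n Hn] := pact_unit H3 x; exists (KQunit K n); apply: Hn.
Qed.

Lemma KQreg_is_rmodule : is_rmodule (KQreg K).
Proof.
apply: (pact_is_rmodule (tgt := ptgt) (cat := pcat)) => //.
  by move=> x p q; rewrite /pcat /= addnA.
exact: pcat_triv.
Qed.

(* The proof of the module axioms is an argument of this alias so that the
   [zmodType] structure on it can be inferred. *)
Definition zcar (M : rmodule K) (HM : is_rmodule M) : Type := mcar M.

HB.instance Definition _ M (HM : is_rmodule M) := boolp.gen_eqMixin (zcar HM).
HB.instance Definition _ M (HM : is_rmodule M) := boolp.gen_choiceMixin (zcar HM).

Section Zmod.
Variables (M : rmodule K) (HM : is_rmodule M).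
Lemma zcar_addA : associative (@madd K M : zcar HM -> zcar HM -> zcar HM).
Proof. by have [H _] := HM; exact: H. Qed.
Lemma zcar_addC : commutative (@madd K M : zcar HM -> zcar HM -> zcar HM).
Proof. by have [_ [H _]] := HM; exact: H. Qed.
Lemma zcar_add0 : left_id (mzero M : zcar HM) (@madd K M).
Proof. by have [_ [_ [H _]]] := HM; exact: H. Qed.
Lemma zcar_addN : left_inverse (mzero M : zcar HM) (@mopp K M) (@madd K M).
Proof. by have [_ [_ [_ [H _]]]] := HM; exact: H. Qed.
HB.instance Definition _ := GRing.isZmodule.Build (zcar HM)
  zcar_addA zcar_addC zcar_add0 zcar_addN.

Definition zact : zcar HM -> KQ K -> zcar HM := @mact K M.

Lemma zactDl (a b : zcar HM) r : zact (a + b) r = zact a r + zact b r.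
Proof. by have [_ [_ [_ [_ [H _]]]]] := HM; exact: H. Qed.
Lemma zactDr (a : zcar HM) r s : zact a (r + s) = zact a r + zact a s.
Proof. by have [_ [_ [_ [_ [_ [H _]]]]]] := HM; exact: H. Qed.
Lemma zactA (a : zcar HM) r s : zact (zact a r) s = zact a (KQmul r s).
Proof. by have [_ [_ [_ [_ [_ [_ [H _]]]]]]] := HM; exact: H. Qed.
Lemma zact_unital (a : zcar HM) : exists r, zact a r = a.
Proof. by have [_ [_ [_ [_ [_ [_ [_ H]]]]]]] := HM; exact: H. Qed.

Lemma zact_unit (a : zcar HM) :
  exists n, forall m, (n <= m)%N -> zact a (KQunit K m) = a.
Proof.
have [r <-] := zact_unital a.
have [n Hn] := pact_unit (tgt := ptgt) (cat := pcat) pcat_triv r.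
by exists n => m /Hn e; rewrite zactA KQmulE e.
Qed.

Lemma zact0l r : zact 0 r = 0.
Proof. by apply: (addrI (zact 0 r)); rewrite -zactDl !addr0. Qed.
Lemma zact0r a : zact a 0 = 0.
Proof. by apply: (addrI (zact a 0)); rewrite -zactDr !addr0. Qed.
Lemma zactNl a r : zact (- a) r = - zact a r.
Proof. by apply: (addrI (zact a r)); rewrite -zactDl !subrr zact0l. Qed.
Lemma zactBl a b r : zact (a - b) r = zact a r - zact b r.
Proof. by rewrite zactDl zactNl. Qed.
Lemma zact_suml I (s : seq I) (F : I -> zcar HM) r :
  zact (\sum_(i <- s) F i) r = \sum_(i <- s) zact (F i) r.
Proof. exact: (big_morph (zact^~ r) (fun a b => zactDl a b r) (zact0l r)). Qed.
End Zmod.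

Section HomTheory.
Variables (M N : rmodule K) (HM : is_rmodule M) (HN : is_rmodule N).

Lemma homD (f : zcar HM -> zcar HN) : @is_hom K M N f ->
  {morph f : a b / a + b}.
Proof. by case. Qed.
Lemma homA (f : zcar HM -> zcar HN) : @is_hom K M N f ->
  forall a r, f (zact a r) = zact (f a) r.
Proof. by case. Qed.
Lemma hom0 (f : zcar HM -> zcar HN) : @is_hom K M N f -> f 0 = 0.
Proof. by move=> hf; apply: (addrI (f 0)); rewrite -homD // !addr0. Qed.
Lemma homN (f : zcar HM -> zcar HN) : @is_hom K M N f -> {morph f : a / - a}.
Proof.
by move=> hf a; apply: (addrI (f a)); rewrite -homD // !subrr hom0.
Qed.
Lemma homB (f : zcar HM -> zcar HN) : @is_hom K M N f ->
  {morph f : a b / a - b}.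
Proof. by move=> hf a b; rewrite homD // homN. Qed.
Lemma is_homI (f : zcar HM -> zcar HN) : {morph f : a b / a + b} ->
  (forall a r, f (zact a r) = zact (f a) r) -> @is_hom K M N f.
Proof. by []. Qed.
Lemma is_hom_add (f g : zcar HM -> zcar HN) :
  @is_hom K M N f -> @is_hom K M N g -> @is_hom K M N (fun x => f x + g x).
Proof.
move=> hf hg; apply: is_homI => [a b|a r].
  by rewrite !homD // addrACA.
by rewrite !homA // zactDl.
Qed.
Lemma is_hom_sub (f g : zcar HM -> zcar HN) :
  @is_hom K M N f -> @is_hom K M N g -> @is_hom K M N (fun x => f x - g x).
Proof.
move=> hf hg; apply: is_homI => [a b|a r].
  by rewrite !homD // opprD addrACA.
by rewrite !homA // zactBl.
Qed.
End HomTheory.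

Lemma is_hom_comp (M N L : rmodule K) (f : M -> N) (g : N -> L) :
  is_hom f -> is_hom g -> is_hom (fun x => g (f x)).
Proof.
by move=> [fD fA] [gD gA]; split => [a b|a r]; rewrite ?fD ?gD ?fA ?gA.
Qed.

Lemma is_hom_id (M : rmodule K) : is_hom (fun x : M => x).
Proof. by []. Qed.

(** Unlike [projective], this form needs no epimorphism: it suffices that
    [p] reaches the values of [f]. *)
Definition lifting (P : rmodule K) : Prop :=
  forall (A B : rmodule K) (p : A -> B) (f : P -> B),
    is_rmodule A -> is_rmodule B -> is_hom p -> is_hom f ->
    (forall x, exists a, p a = f x) ->
    exists t : P -> A, is_hom t /\ forall x, p (t x) = f x.

Section Pullback.
Variables (P A B : rmodule K) (p : A -> B) (f : P -> B).
Hypotheses (HP : is_rmodule P) (HA : is_rmodule A) (HB : is_rmodule B).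
Hypotheses (hp : is_hom p) (hf : is_hom f).

Let p' : zcar HA -> zcar HB := p.
Let f' : zcar HP -> zcar HB := f.
Let car := {z : zcar HP * zcar HA | p' z.2 == f' z.1}.

Fact pullback0 : p' (0 : zcar HP * zcar HA).2 == f' (0 : zcar HP * zcar HA).1.
Proof. by rewrite !hom0. Qed.
Fact pullbackD (x y : car) : p' (sval x + sval y).2 == f' (sval x + sval y).1.
Proof. by rewrite /= !homD // (eqP (svalP x)) (eqP (svalP y)). Qed.
Fact pullbackN (x : car) : p' (- sval x).2 == f' (- sval x).1.
Proof. by rewrite /= !homN // (eqP (svalP x)). Qed.
Fact pullbackA (x : car) r :
  p' (zact (sval x).1 r, zact (sval x).2 r).2
  == f' (zact (sval x).1 r, zact (sval x).2 r).1.
Proof. by rewrite /= !homA // (eqP (svalP x)). Qed.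

Let mk z (E : p' z.2 == f' z.1) : car := exist _ z E.

Definition pullback : rmodule K :=
  @RModule K car (@mk 0 pullback0) (fun x y => @mk (sval x + sval y) (pullbackD x y))
    (fun x => @mk (- sval x) (pullbackN x))
    (fun x r => @mk (zact (sval x).1 r, zact (sval x).2 r) (pullbackA x r)).

Lemma pullback_is_rmodule : is_rmodule pullback.
Proof.
do !split => /=.
- by move=> x y z; apply: val_inj; exact: addrA.
- by move=> x y; apply: val_inj; exact: addrC.
- by move=> x; apply: val_inj; exact: add0r.
- by move=> x; apply: val_inj; exact: addNr.
- by move=> x y r; apply: val_inj; congr pair; exact: zactDl.
- by move=> x r s; apply: val_inj; congr pair; exact: zactDr.
- by move=> x r s; apply: val_inj; congr pair; exact: zactA.
- move=> [[x a] xa]; have [n Hx] := zact_unit x; have [m Ha] := zact_unit a.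
  exists (KQunit K (maxn n m)); apply: val_inj => /=.
  by rewrite Hx ?Ha ?leq_maxl ?leq_maxr.
Qed.

(** The first projection of the pullback is an epimorphism onto [P]; the second component of its
    section is the lift. *)
Lemma pullback_lift : projective P -> (forall x, exists a, p a = f x) ->
  exists t : P -> A, is_hom t /\ forall x, p (t x) = f x.
Proof.
move=> PP ex; have hp1 : @is_hom K pullback P (fun z : car => (sval z).1) by [].
case: (PP _ _ pullback_is_rmodule hp1) => [x|s [hs sK]].
  have [a pa] := ex x; have E : p' (x, a : zcar HA).2 == f' (x : zcar HP, a).1.
    exact/eqP.
  by exists (@mk (x, a) E).
exists (fun x => (sval (s x : car)).2); split=> [|x].
  by case: hs => sD sA; split=> [a b|a r]; rewrite ?sD ?sA.
by have /eqP := svalP (s x : car); rewrite /p' /f' sK.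
Qed.
End Pullback.

Lemma projective_lifting (P : rmodule K) :
  is_rmodule P -> projective P -> lifting P.
Proof. by move=> HP PP A B p f HA HB hp hf; apply: pullback_lift. Qed.

Section Quotient.
Variables (M : rmodule K) (HM : is_rmodule M) (I : M -> Prop).
Hypothesis I0 : I (mzero M).
Hypothesis ID : forall a b, I a -> I b -> I (madd a b).
Hypothesis IN : forall a, I a -> I (mopp a).
Hypothesis IA : forall a r, I a -> I (mact a r).

Let J : zcar HM -> Prop := I.
Let cls (x : zcar HM) : qcar I := qcls I x.

Lemma qcls_eq (x y : zcar HM) : J (x - y) -> cls x = cls y.
Proof.
move=> xy; have E : coset I x = coset I y.
  apply: boolp.funext => z; apply: boolp.propext; rewrite /coset; split => Jz.
    have -> : madd z (mopp y) = ((z : zcar HM) - x) + (x - y) :> zcar HM.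
      by rewrite addrA subrK.
    exact: ID.
  have -> : madd z (mopp x) = ((z : zcar HM) - y) - (x - y) :> zcar HM.
    by rewrite opprB addrA subrK.
  by apply: ID => //; apply: IN.
exact: boolp.eq_exist.
Qed.

Lemma qcls_inj (x y : zcar HM) : cls x = cls y -> J (x - y).
Proof.
move=> /(congr1 sval) /= E.
have : coset I x x by rewrite /coset; have -> : madd x (mopp x) = mzero M by exact: (subrr x).
by rewrite E.
Qed.

(** The operations of [quot] act on chosen representatives; this identity makes the class map
    compatible with them. *)
Lemma qrepK (A : qcar I) : cls (qrep A) = A.
Proof.
rewrite /qrep; case: constructive_indefinite_description => x /= Ax.
by case: A Ax => A HA /= E; subst A; exact: boolp.eq_exist.
Qed.

Lemma qcls_D (x y : zcar HM) : cls (x + y) = madd (cls x : quot I) (cls y).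
Proof.
apply: qcls_eq; rewrite opprD addrACA.
by apply: ID; apply: qcls_inj; rewrite qrepK.
Qed.

Lemma qcls_N (x : zcar HM) : cls (- x) = mopp (cls x : quot I).
Proof.
apply: qcls_eq; rewrite -opprD; apply: IN.
by apply: qcls_inj; rewrite qrepK.
Qed.

Lemma qcls_A (x : zcar HM) r : cls (zact x r) = mact (cls x : quot I) r.
Proof.
apply: qcls_eq; rewrite -zactBl; apply: IA.
by apply: qcls_inj; rewrite qrepK.
Qed.

Lemma qcls_is_hom : @is_hom K M (quot I) (qcls I).
Proof. by split; [exact: qcls_D | exact: qcls_A]. Qed.

Lemma quot_is_rmodule : is_rmodule (quot I).
Proof.
have S (A : quot I) : exists x, A = cls x by exists (qrep A); rewrite qrepK.
do !split.
- move=> A B C; have [[a ->] [b ->] [c ->]] := And3 (S A) (S B) (S C).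
  by rewrite -!qcls_D addrA.
- by move=> A B; have [[a ->] [b ->]] := conj (S A) (S B); rewrite -!qcls_D addrC.
- by move=> A; have [a ->] := S A; rewrite -[mzero _]/(cls 0) -qcls_D add0r.
- by move=> A; have [a ->] := S A; rewrite -[mzero _]/(cls 0) -qcls_N -qcls_D addNr.
- move=> A B r; have [[a ->] [b ->]] := conj (S A) (S B).
  by rewrite -(qcls_D a b) -!qcls_A -qcls_D zactDl.
- by move=> A r s; have [a ->] := S A; rewrite -!qcls_A -!qcls_D zactDr.
- by move=> A r s; have [a ->] := S A; rewrite -!qcls_A zactA.
- move=> A; have [a ->] := S A; have [r Hr] := zact_unital a.
  by exists r; rewrite -qcls_A Hr.
Qed.
End Quotient.

Lemma subgen_is_rmodule (M : rmodule K) (S : M -> Prop) :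
  is_rmodule M -> is_rmodule (subgen S).
Proof.
have val_inj' (x y : subgen S) : sval x = sval y -> x = y.
  case: x y => [x Hx] [y Hy] /= E; subst y.
  by rewrite (boolp.Prop_irrelevance Hx Hy).
move=> [H1 [H2 [H3 [H4 [H5 [H6 [H7 H8]]]]]]].
do !split; last first.
  by move=> a; case: (H8 (sval a)) => r Hr; exists r; apply: val_inj'.
all: by move=> *; apply: val_inj' => /=; auto.
Qed.

Lemma sval_is_hom (M : rmodule K) (S : M -> Prop) :
  @is_hom K (subgen S) M sval.
Proof. by []. Qed.

End Modules.

(** A presentation [psi : F -> F], [pi : F -> M] of [M] by a module with the
    lifting property computes [Ext] from an arbitrary projective resolution
    [P] of [M], by comparing [P] with it; [sigma] is the (set-theoretic)
    left inverse of [psi] up to the idempotent [rho] that cuts the kernel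
    of [psi] out of [F]. *)
Section Presentation.
Variables (K : fieldType) (M F N : rmodule K).
Hypotheses (HM : is_rmodule M) (HF : is_rmodule F) (HN : is_rmodule N).
Hypothesis liftF : lifting F.
Variables (pi : zcar HF -> zcar HM) (psi rho sigma : zcar HF -> zcar HF).
Hypotheses (hpi : @is_hom K F M pi) (hpsi : @is_hom K F F psi) (hrho : @is_hom K F F rho).
Hypothesis pi_surj : forall x, exists y, pi y = x.
Hypothesis ker_pi : forall x, pi x = 0 <-> exists l, x = psi l.
Hypothesis psi_rho : forall x, psi (rho x) = psi x.
Hypothesis sigma_psi : forall x, sigma (psi x) = rho x.

Variables (P : nat -> rmodule K) (d : forall k, P k.+1 -> P k) (eps : P 0%N -> M).
Hypothesis resP : @proj_resolution K M P d eps.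

Let HP k : is_rmodule (P k). Proof. by case: resP. Qed.
Let liftP k : lifting (P k).
Proof. by apply: projective_lifting => //; case: resP => _ []. Qed.
Let dz k : zcar (HP k.+1) -> zcar (HP k) := @d k.
Let ez : zcar (HP 0) -> zcar HM := eps.
Let hd k : @is_hom K (P k.+1) (P k) (@dz k).
Proof. by have [_ [_ [H _]]] := resP; exact: H. Qed.
Let he : @is_hom K (P 0) M ez.
Proof. by have [_ [_ [_ [H _]]]] := resP; exact: H. Qed.
Let e_surj x : exists y, ez y = x.
Proof. by have [_ [_ [_ [_ [H _]]]]] := resP; exact: H. Qed.
Let ker_e x : ez x = 0 <-> exists y, x = dz y.
Proof. by have [_ [_ [_ [_ [_ [H _]]]]]] := resP; exact: H. Qed.
Let ker_d k x : @dz k x = 0 <-> exists y, x = @dz k.+1 y.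
Proof. by have [_ [_ [_ [_ [_ [_ H]]]]]] := resP; exact: H. Qed.

(** The maps [u] and [v : F -> P 0] lift [eps] and [pi] through each other, [t] is a homotopy with
    [d t = 1 - v u], and [k] satisfies [d k = v psi]. As [u (d y)] lies in the kernel of [pi], it is
    some [psi l], and the last clause follows. *)
Lemma comparison : exists (u : zcar (HP 0) -> zcar HF)
    (t : zcar (HP 0) -> zcar (HP 1)) (k : zcar HF -> zcar (HP 1)),
  [/\ @is_hom K (P 0) F u, @is_hom K (P 0) (P 1) t, @is_hom K F (P 1) k,
      forall x, k (rho x) = k x &
      forall y, exists l, u (dz y) = psi l /\ dz (t (dz y) + k l) = dz y].
Proof.
have [u [hu pu]] : exists u : zcar (HP 0) -> zcar HF,
    @is_hom K (P 0) F u /\ forall x, pi (u x) = ez x.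
  exact: (liftP HF HM hpi he).
have [v [hv ev]] : exists v : zcar HF -> zcar (HP 0),
    @is_hom K F (P 0) v /\ forall x, ez (v x) = pi x.
  exact: (liftF (HP 0) HM he hpi).
have hvu : @is_hom K (P 0) (P 0) (fun x : zcar (HP 0) => x - v (u x)).
  by apply: (is_hom_sub (HM := HP _)); [exact: is_hom_id | exact: is_hom_comp hu hv].
have [t [ht dt]] : exists t : zcar (HP 0) -> zcar (HP 1),
    @is_hom K (P 0) (P 1) t /\ forall x, dz (t x) = x - v (u x).
  apply: (liftP (HP 1) (HP 0) (hd 0) hvu) => x.
  have [|y ->] := (ker_e ((x : zcar (HP 0)) - v (u x))).1; last by exists y.
  by rewrite homB // ev pu subrr.
have [k [hk dk]] : exists k : zcar HF -> zcar (HP 1),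
    @is_hom K F (P 1) k /\ forall x, dz (k x) = v (psi x).
  apply: (liftF (HP 1) (HP 0) (hd 0) (is_hom_comp hpsi hv)) => x.
  have [|y ->] := (ker_e (v (psi x))).1; last by exists y.
  by rewrite ev; apply/ker_pi; exists x.
(* Passing to [k rho] keeps [d k = v psi] and makes [k l] depend only on [psi l]. *)
exists u, t, (fun x => k (rho x)); split=> // [|x|y].
- exact: is_hom_comp hrho hk.
- by rewrite -[rho (rho x)]sigma_psi psi_rho sigma_psi.
- have [|l el] := (ker_pi (u (dz y))).1.
    by rewrite pu; apply/ker_e; exists y.
  by exists l; split=> //; rewrite homD // dt dk psi_rho el subrK.
Qed.

(** A cocycle vanishes on the image of the next differential, which is the kernel of this one. *)
Let same_image k (f : zcar (HP k.+1) -> zcar HN) y y' :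
  @is_hom K (P k.+1) N f -> (forall x, f (@dz k.+1 x) = 0) ->
  dz y = dz y' -> f y = f y'.
Proof.
move=> hf f0 e; have [|z yz] := (ker_d (y - y')).1.
  by rewrite homB // e subrr.
by apply/eqP; rewrite -subr_eq0 -homB // yz f0.
Qed.

(** Extend [f k] along [psi] to [G] and take [f t + G u]: at [d y] it equals [f (t (d y) + k l)],
    whose argument has the same differential as [y]. *)
Lemma presentation_Ext1 (f : P 1 -> N) :
  (forall h : F -> N, is_hom h -> (forall x, h (rho x) = h x) ->
     exists H : F -> N, is_hom H /\ forall x, H (psi x) = h x) ->
  is_hom f -> (forall x, f (d x) = mzero N) ->
  exists g : P 0%N -> N, is_hom g /\ (forall x, f x = g (d x)).
Proof.
move=> ext hf f0; have [u [t [k [hu ht hk krho H]]]] := comparison.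
case: (ext _ (is_hom_comp hk hf)) => [x|G [hG eG]]; first by rewrite krho.
exists (fun x => (f (t x) : zcar HN) + G (u x)); split.
  exact: (is_hom_add (HM := HP _) (is_hom_comp ht hf) (is_hom_comp hu hG)).
move=> y; have [l [el e]] := H y; rewrite [u _]el eG.
by rewrite -(homD (HM := HP 1) (HN := HN) (f := f) hf); apply: same_image.
Qed.

(** From [y] one subtracts an element with the same differential that depends only on [d y]. The
    retraction onto the kernel expresses that [M] has projective dimension at most one. *)
Lemma syzygy_retract : exists e : zcar (HP 1) -> zcar (HP 1),
  [/\ @is_hom K (P 1) (P 1) e, forall y, dz (e y) = 0 &
      forall y, dz y = 0 -> e y = y].
Proof.
have [u [t [k [hu ht hk krho H]]]] := comparison.
have sE y l : u (dz y) = psi l -> k (sigma (u (dz y))) = k l.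
  by move=> ->; rewrite sigma_psi krho.
(* Here [sigma] is just a function, but [k sigma] sends [psi l] to [k l], so linearity can be read
   off from preimages under [psi]. *)
have hs : @is_hom K (P 1) (P 1) (fun y => k (sigma (u (dz y)))).
  apply: (@is_homI _ _ _ (HP 1) (HP 1)) => [a b|a r].
    have [[l [el _]] [m [em _]]] := (H a, H b).
    rewrite (sE a l) // (sE b m) // (sE _ (l + m)) ?(homD hk) //.
    by rewrite !(homD hu, homD (hd _)) el em (homD hpsi).
  have [l [el _]] := H a; rewrite (sE a l) // (sE _ (zact l r)) ?(homA hk) //.
  by rewrite (homA (hd 0)) (homA hu) el (homA hpsi).
exists (fun y => y - (t (dz y) + k (sigma (u (dz y))))); split.
- apply: (is_hom_sub (HM := HP _)); first exact: is_hom_id.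
  exact: (is_hom_add (HM := HP _) (is_hom_comp (hd 0) ht) hs).
- by move=> y; have [l [el e]] := H y; rewrite (sE y l) // homB // e subrr.
- move=> y y0; rewrite (sE y 0) ?y0 ?(hom0 hk) ?(hom0 ht) ?addr0 ?subr0 //.
  by rewrite (hom0 hu) (hom0 hpsi).
Qed.

(** A retraction onto the kernel of one differential lifts through the next to a [T] with
    [d T d = d]; then [1 - T d] is a retraction one degree higher. *)
Lemma splitting_differentials m : exists T : zcar (HP m.+1) -> zcar (HP m.+2),
  @is_hom K (P m.+1) (P m.+2) T /\ forall y, dz (T (dz y)) = dz y.
Proof.
have lift n (e : zcar (HP n.+1) -> zcar (HP n.+1)) :
    @is_hom K (P n.+1) (P n.+1) e -> (forall y, dz (e y) = 0) ->
    (forall y, dz y = 0 -> e y = y) ->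
    exists T : zcar (HP n.+1) -> zcar (HP n.+2),
      @is_hom K (P n.+1) (P n.+2) T /\ forall y, dz (T (dz y)) = dz y.
  move=> hE e0 eK.
  have [x|T [hT dT]] := liftP (HP n.+2) (HP n.+1) (hd n.+1) hE.
    by have [y ->] := (ker_d (e x)).1 (e0 x); exists y.
  exists T; split=> // y; rewrite [LHS]dT eK //.
  by apply/ker_d; exists y.
elim: m => [|m [T [hT dT]]].
  by have [e [hE e0 eK]] := syzygy_retract; apply: lift hE e0 eK.
apply: (lift _ (fun y => y - T (dz y))).
- apply: (is_hom_sub (HM := HP _)); first exact: is_hom_id.
  exact: is_hom_comp (hd m.+1) hT.
- by move=> y; rewrite homB // dT subrr.
- by move=> y ->; rewrite (hom0 hT) subr0.
Qed.

Lemma presentation_Ext_ge2 m (f : P m.+2 -> N) :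
  is_hom f -> (forall x, f (d x) = mzero N) ->
  exists g : P m.+1 -> N, is_hom g /\ (forall x, f x = g (d x)).
Proof.
move=> hf f0; have [T [hT dT]] := splitting_differentials m.
exists (fun x => f (T x)); split; first exact: is_hom_comp hT hf.
by move=> x; apply: same_image => //; rewrite dT.
Qed.
End Presentation.

(** * Free modules over the path algebra *)

Section FreeModule.
Variables (K : fieldType) (I : choiceType).

Definition free_mod : rmodule K :=
  @RModule K {malg K[(I * path)%type]} 0 +%R -%R
    (pact (fun k => ptgt k.2) (fun k q => (k.1, pcat k.2 q))).

Lemma free_mod_is_rmodule : is_rmodule free_mod.
Proof.
apply: pact_is_rmodule => //= [[i p] q r|[i p]]; last by rewrite pcat_triv.
by rewrite /pcat /= addnA.
Qed.

Let HF := free_mod_is_rmodule.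

(* The basis elements are locked because failing conversion tests between
   explicit finitely supported functions are prohibitively expensive. *)
Fact fb_key : unit. Proof. by []. Qed.
Definition fb : K -> I -> path -> {malg K[(I * path)%type]} :=
  locked_with fb_key (fun c i p => << c *g (i, p) >>).

Lemma fbE c i p : fb c i p = << c *g (i, p) >>.
Proof. by rewrite /fb unlock. Qed.

Lemma free_ind (P : {malg K[(I * path)%type]} -> Prop) :
  (forall c i p, P (fb c i p)) -> (forall x y, P x -> P y -> P (x + y)) ->
  P 0 -> forall x, P x.
Proof. by move=> PU; apply: malg_ind => c [i p]; rewrite -fbE. Qed.

Lemma lext_fb (V : lmodType K) (phi : I * path -> V) c i p :
  lext phi (fb c i p) = c *: phi (i, p).
Proof. by rewrite fbE lextU. Qed.

Lemma fb_scale c i p : fb c i p = c *: fb 1 i p.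
Proof. by rewrite !fbE malgUE. Qed.

Lemma free_actUU c i p d q : ptgt p = psrc q ->
  @mact K free_mod (fb c i p) << d *g q >> = (fb (c * d) i (pcat p q)).
Proof. by move=> pq; rewrite !fbE /= pactUUcat. Qed.

Lemma free_gen c i p :
  (fb c i p) = @mact K free_mod (fb 1 i (triv (psrc p))) << c *g p >>.
Proof.
by rewrite free_actUU // mul1r; case: p => t l.
Qed.

Section Extension.
Variables (E : rmodule K) (HE : is_rmodule E) (e : I -> nat -> zcar HE).

(** [KQ] is the direct sum of the [e_m KQ], so the generators are the [(i, triv m)]. Each goes to
    [e i m] times [triv m], which makes every family [e] admissible. *)
Definition free_ext : zcar HF -> zcar HE := locked_with fb_key
  (mext (fun k c => zact (e k.1 (psrc k.2)) << c *g k.2 >>)).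

Lemma free_extU c i p : free_ext (fb c i p) = zact (e i (psrc p)) << c *g p >>.
Proof. by rewrite fbE /free_ext unlock mextU // => t a b; rewrite monalgUD zactDr. Qed.

Lemma free_extD : {morph free_ext : x y / x + y}.
Proof. by move=> x y; rewrite /free_ext unlock mextD // => t a b; rewrite monalgUD zactDr. Qed.

Let free_ext0 : free_ext 0 = 0.
Proof. by apply: (addrI (free_ext 0)); rewrite -free_extD !addr0. Qed.

Lemma free_ext_is_hom : @is_hom K free_mod E free_ext.
Proof.
apply: (@is_homI _ _ _ HF HE) => [|x r]; first exact: free_extD.
elim/free_ind: x => [c i p|x y IHx IHy|]; last by rewrite (zact0l HF) free_ext0 zact0l.
- elim/malg_ind: r => [d q|x y IHx IHy|]; last by rewrite !zact0r free_ext0.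
  + rewrite [in RHS]free_extU zactA KQmulE.
    have [pq|pq] := eqVneq (ptgt p) (psrc q).
      by rewrite /zact free_actUU // free_extU psrc_pcat // pactUUcat.
    by rewrite fbE pactUU0 // zact0r [zact _ _]pactUU0 // free_ext0.
  + by rewrite !zactDr free_extD IHx IHy.
- by rewrite (zactDl (HM := HF)) !free_extD zactDl IHx IHy.
Qed.
End Extension.

Section Endo.
Variable e : I -> nat -> {malg K[(I * path)%type]}.
Definition free_endo : {malg K[(I * path)%type]} -> {malg K[(I * path)%type]} :=
  free_ext (HE := HF) e.

Lemma free_endoU c i p :
  free_endo (fb c i p) = @mact K free_mod (e i (psrc p)) << c *g p >>.
Proof. exact: (free_extU (HE := HF)). Qed.

Lemma free_endo_is_hom : @is_hom K free_mod free_mod free_endo.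
Proof. exact: (free_ext_is_hom (HE := HF)). Qed.
End Endo.

Section FreeHom.
Variables (E : rmodule K) (HE : is_rmodule E).
Variable f : {malg K[(I * path)%type]} -> zcar HE.
Hypothesis hf : @is_hom K free_mod E f.
Lemma free_homD : {morph f : x y / x + y}.
Proof. exact: (homD (HM := HF)). Qed.
Lemma free_hom0 : f 0 = 0.
Proof. exact: (hom0 (HM := HF)). Qed.
Lemma free_homN : {morph f : x / - x}.
Proof. exact: (homN (HM := HF)). Qed.
Lemma free_homB : {morph f : x y / x - y}.
Proof. exact: (homB (HM := HF)). Qed.
End FreeHom.

Section EndoHom.
Variable f : {malg K[(I * path)%type]} -> {malg K[(I * path)%type]}.
Hypothesis hf : @is_hom K free_mod free_mod f.
Lemma endoD : {morph f : x y / x + y}.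
Proof. exact: (homD (HM := HF) (HN := HF)). Qed.
Lemma endo0 : f 0 = 0.
Proof. exact: (hom0 (HM := HF) (HN := HF)). Qed.
Lemma endoN : {morph f : x / - x}.
Proof. exact: (homN (HM := HF) (HN := HF)). Qed.
Lemma endoB : {morph f : x y / x - y}.
Proof. exact: (homB (HM := HF) (HN := HF)). Qed.
End EndoHom.

Lemma free_act0l r : @mact K free_mod 0 r = 0.
Proof. exact: pact0l. Qed.
Lemma free_actDl (x y : {malg K[(I * path)%type]}) r :
  @mact K free_mod (x + y) r
  = (@mact K free_mod x r : {malg K[(I * path)%type]}) + @mact K free_mod y r.
Proof. exact: pactDl. Qed.
Lemma free_actBl (x y : {malg K[(I * path)%type]}) r :
  @mact K free_mod (x - y) r
  = (@mact K free_mod x r : {malg K[(I * path)%type]}) - @mact K free_mod y r.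
Proof. by rewrite free_actDl /= pactNl. Qed.

Lemma free_hom_eq (E : rmodule K) (f g : free_mod -> E) : is_rmodule E ->
  is_hom f -> is_hom g ->
  (forall i m, f (fb 1 i (triv m)) = g (fb 1 i (triv m))) -> forall x, f x = g x.
Proof.
move=> HE hf hg fg; apply: free_ind => [c i p|x y|].
- by rewrite free_gen; case: hf hg => _ fA [_ gA]; rewrite fA gA fg.
- by rewrite (free_homD (HE := HE) hf) (free_homD (HE := HE) hg) => -> ->.
- by rewrite (free_hom0 (HE := HE) hf) (free_hom0 (HE := HE) hg).
Qed.

(** A chosen preimage may be changed by [triv m], but its product with [triv m] still maps to the
    right value, since the generator is fixed by [triv m]. *)
Lemma free_lifting : lifting free_mod.
Proof.
move=> A B p f HA HB hp hf ex.
pose a i m := projT1 (boolp.cid (ex (fb 1 i (triv m)))).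
have pa i m : p (a i m) = f (fb 1 i (triv m)) by rewrite /a; case: boolp.cid.
have ht := free_ext_is_hom (HE := HA) a.
exists (free_ext (HE := HA) a); split=> //.
apply: (free_hom_eq HB (is_hom_comp ht hp) hf) => i m.
rewrite free_extU /= [LHS](homA (HM := HA) (HN := HB) hp) /zact.
have -> : psrc (triv m) = m by rewrite /psrc /= addn0.
rewrite pa; case: hf => _ <-; rewrite free_actUU ?mulr1 //=.
by rewrite /psrc /= addn0.
Qed.
End FreeModule.

(** * The presentation of [Momega1] and the extension problem *)

Section Limit.
Variables (disp : Order.disp_t) (W : orderType disp).
Lemma limitbP (a : W) : reflect (is_limit a) (limitb a).
Proof. by rewrite /limitb; case: excluded_middle_informative => H; constructor. Qed.

(** This says [n_g = m] for a successor [g]. *)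
Definition succ_type (m : nat) (g : W) : Prop :=
  exists d, (is_zero d \/ is_limit d) /\ plus_nat d m.+1 g.

Lemma succ_type_not_limit m (g : W) : succ_type m g -> ~~ limitb g.
Proof.
by case=> d [_ [b [_ bg]]]; apply/limitbP => -[_ []]; exists b.
Qed.
End Limit.

Section Momega.
Variables (K : fieldType) (disp : Order.disp_t) (W : orderType disp).
Variable zeta : W -> nat -> W.
Hypothesis special : special_ladder zeta.

Local Notation F := (Fmod K W).
Local Notation fidx := (@Fidx disp W).

Local Notation HF := (@free_mod_is_rmodule K fidx).
Local Notation FZ := {malg K[(fidx * path)%type]}.

Definition fidx0 (xi : W) : fidx :=
  exist (fun j : W * nat => limitb j.1 || (j.2 == 0%N)) (xi, 0%N) (orbT (limitb xi)).

(** Selects the basis elements whose classes generate [Momega1]: copy [0] only, with every vertex at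
    a limit and just the vertex [n_g] at a successor [g]. *)
Definition good (i : fidx) (m : nat) : bool :=
  ((val i).2 == 0%N) && (limitb (val i).1 || boolp.asbool (succ_type m (val i).1)).

Lemma good_idx0 i m : good i m -> i = fidx0 (val i).1.
Proof. by case: i => -[x c] ?; case/andP => /= /eqP c0 _; apply: val_inj; rewrite /= c0. Qed.

Lemma good_limit a m : limitb a -> good (fidx0 a) m.
Proof. by rewrite /good /= => ->. Qed.

Lemma good_zeta a m : limitb a -> good (fidx0 (zeta a m)) m.
Proof.
move=> /limitbP /special.2 /(_ m) [d [_ H]]; rewrite /good /=.
by apply/orP; right; apply/boolp.asboolP; exists d.
Qed.

Lemma zeta_not_limit a m : limitb a -> ~~ limitb (zeta a m).
Proof.
move=> /limitbP /special.2 /(_ m) [d [_ H]].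
by apply: (@succ_type_not_limit _ _ m); exists d.
Qed.

(** Generators that are not [good] must lie in the kernel of [pi], hence are fixed; good ones at
    successors carry no relation and go to zero. *)
Definition psi : FZ -> FZ := free_endo (fun i m =>
  if ~~ good i m then fb 1 i (triv m)
  else if limitb (val i).1 then Ggen K zeta (val i).1 m else 0).

Definition rho : FZ -> FZ := free_endo (fun i m =>
  if good i m && ~~ limitb (val i).1 then 0 else fb 1 i (triv m)).

(** Only [K]-linear. At a limit, [psi] sends a path [p] to [a p - p] up to a term at a ladder point;
    summing over the shorter paths with the same target inverts this difference. *)
Definition sigma : FZ -> FZ := locked_with fb_key (lext (fun k : fidx * path =>
  if ~~ good k.1 (psrc k.2) then fb 1 k.1 k.2
  else if limitb (val k.1).1 then \sum_(j < k.2.2) fb 1 k.1 (k.2.1, j : nat)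
  else 0 : {malg K[(fidx * path)%type]})).

Lemma psi_is_hom : @is_hom K F F psi.
Proof. exact: free_endo_is_hom. Qed.
Lemma rho_is_hom : @is_hom K F F rho.
Proof. exact: free_endo_is_hom. Qed.

Lemma ebaseE a n : ebase K a n = fb 1 (fidx0 a) (triv n).
Proof. by rewrite fbE. Qed.

Lemma GgenE a n : Ggen K zeta a n =
  (fb 1 (fidx0 (zeta a n)) (triv n)) - fb 1 (fidx0 a) (triv n) + fb 1 (fidx0 a) (arrow n).
Proof.
rewrite /Ggen !ebaseE; congr (_ + _).
have pq : ptgt (triv n.+1) = psrc (arrow n) by rewrite /psrc /= addn1.
by have := free_actUU (K := K) 1 (fidx0 a) 1 pq; rewrite mulr1.
Qed.

Lemma psiU c i p : psi (fb c i p) =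
  if ~~ good i (psrc p) then fb c i p
  else if limitb (val i).1 then
    (fb c (fidx0 (zeta (val i).1 (psrc p))) p) - fb c i p
    + fb c i (p.1, p.2.+1) else 0.
Proof.
rewrite /psi free_endoU; case g: (good i (psrc p)) => /=; last by rewrite [RHS]free_gen.
case: (limitb _); last exact: free_act0l.
rewrite GgenE -(good_idx0 g) [LHS]free_actDl; congr (_ + _).
  by rewrite [LHS]free_actBl; congr (_ - _); exact/esym/free_gen.
have pq : ptgt (arrow (psrc p)) = psrc p by [].
by rewrite [LHS](free_actUU 1 i c pq) mul1r; case: p {g pq}.
Qed.

Lemma rhoU c i p : rho (fb c i p) =
  if good i (psrc p) && ~~ limitb (val i).1 then 0 else fb c i p.
Proof.
rewrite /rho free_endoU; case: (good i (psrc p) && _); first exact: free_act0l.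
by rewrite [RHS]free_gen.
Qed.

Lemma sigmaU c i p : sigma (fb c i p) =
  if ~~ good i (psrc p) then fb c i p
  else if limitb (val i).1 then \sum_(j < p.2) (fb c i (p.1, j : nat))
  else 0.
Proof.
rewrite /sigma unlock lext_fb /=; case: (good i (psrc p)) => /=; last by rewrite -fb_scale.
case: (limitb _); last by rewrite scaler0.
by rewrite scaler_sumr; apply: eq_bigr => j _; rewrite -fb_scale.
Qed.

(** At a limit the ladder term is killed, and the other two give sums over lengths below [l] and
    below [l + 1], leaving the path of length [l]. *)
Lemma sigma_psi x : sigma (psi x) = rho x.
Proof.
have sD : {morph sigma : a b / a + b} by rewrite /sigma unlock; exact: lextD.
have sN : {morph sigma : a / - a} by rewrite /sigma unlock; exact: lextN.
have s0 : sigma 0 = 0 by rewrite /sigma unlock lext0.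
elim/free_ind: x => [c i p|x y IHx IHy|].
- rewrite psiU rhoU; case g: (good i (psrc p)) => /=; last by rewrite sigmaU g.
  case l: (limitb (val i).1) => //=.
  have gz : good (fidx0 (zeta (val i).1 (psrc p))) (psrc p) by exact: good_zeta.
  rewrite sD sD sN !sigmaU gz /= (negbTE (zeta_not_limit _ l)) g l.
  have -> : psrc (p.1, p.2.+1) = (psrc p).+1 by rewrite /psrc /= addnS.
  have -> : good i (psrc p).+1 by rewrite (good_idx0 g); apply: good_limit.
  rewrite /= big_ord_recr /= add0r addrA addNr add0r.
  by case: p {g gz}.
- rewrite (endoD psi_is_hom) [LHS]sD [RHS](endoD rho_is_hom).
  by rewrite IHx IHy.
- by rewrite (endo0 psi_is_hom) s0 (endo0 rho_is_hom).
Qed.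

Lemma psi_rho x : psi (rho x) = psi x.
Proof.
apply: (free_hom_eq HF (is_hom_comp rho_is_hom psi_is_hom) psi_is_hom) => i m.
rewrite rhoU; case g: (good i _); case l: (limitb _) => //=.
by rewrite psiU g l (endo0 psi_is_hom).
Qed.

Local Notation Q := (FmodI K zeta).
Local Notation Mo := (Momega1 K zeta).
Local Notation qc := (@qcls K F (@Isub K disp W zeta)).

Lemma FmodI_is_rmodule : is_rmodule Q.
Proof.
apply: (quot_is_rmodule HF); first exact: gen0.
- exact: genD.
- exact: genN.
- exact: genA.
Qed.

Lemma class_is_hom : @is_hom K F Q qc.
Proof.
apply: (qcls_is_hom HF); first exact: gen0.
- exact: genD.
- exact: genN.
- exact: genA.
Qed.

Lemma class_eq0 (x : FZ) : qc x = qc 0 <-> Isub zeta x.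
Proof.
split=> [E|Ix].
  by have := @qcls_inj K F HF (@Isub K disp W zeta) (@gen0 _ _ _) x 0 E; rewrite [_ - _]subr0.
apply: (qcls_eq (HM := HF)); [exact: genD | exact: genN |].
by rewrite [_ - _](subr0 (x : FZ)).
Qed.

Lemma Momega1_is_rmodule : is_rmodule Mo.
Proof. by apply: subgen_is_rmodule; exact: FmodI_is_rmodule. Qed.
Local Notation HMo := Momega1_is_rmodule.

(** [Momega1] is a submodule of [FmodI], so the generators outside it are erased before passing to
    classes. *)
Definition proj_gen (i : fidx) (m : nat) : FZ := if good i m then fb 1 i (triv m) else 0.

Definition proj : FZ -> FZ := free_endo proj_gen.

Lemma proj_is_hom : @is_hom K F F proj.
Proof. exact: free_endo_is_hom. Qed.

Lemma projU c i p :
  proj (fb c i p) = if good i (psrc p) then fb c i p else 0.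
Proof.
rewrite /proj free_endoU /proj_gen; case: (good i _); last exact: free_act0l.
by rewrite [RHS]free_gen.
Qed.

Lemma proj_gen_in_Mo i m : gen (@Mgens K disp W zeta) (qc (proj_gen i m)).
Proof.
rewrite /proj_gen; case: ifP => g; last exact: (@gen0 K Q).
move=> S HS _ _ _ _; apply: HS; rewrite (good_idx0 g).
case: (limitbP (val i).1) => l.
  by right; exists (val i).1, m; rewrite ebaseE.
left; exists (val i).1, m; rewrite ebaseE; split=> //.
by case/andP: g => _ /orP[/limitbP //|/boolp.asboolP].
Qed.

Definition pi : FZ -> zcar HMo :=
  free_ext (HE := HMo) (fun i m => exist _ _ (proj_gen_in_Mo i m)).

Lemma pi_is_hom : @is_hom K F Mo pi.
Proof. exact: (@free_ext_is_hom _ _ _ HMo). Qed.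

Lemma val_pi x : sval (pi x) = qc (proj x).
Proof.
move: x; apply: (@free_hom_eq K fidx Q (fun x => sval (pi x)) (fun x => qc (proj x))).
- exact: FmodI_is_rmodule.
- exact: is_hom_comp pi_is_hom (sval_is_hom _).
- exact: is_hom_comp proj_is_hom class_is_hom.
- move=> i m; rewrite /pi /proj free_extU free_endoU.
  exact/esym/(class_is_hom.2 (proj_gen i (psrc (triv m))) << triv m >>).
Qed.

Lemma val_Mo_inj (x y : Mo) : sval x = sval y -> x = y.
Proof. by case: x y => [x ?] [y ?] /= E; apply: boolp.eq_exist. Qed.

Lemma pi_eq0 x : pi x = 0 <-> Isub zeta (proj x).
Proof.
rewrite -class_eq0 -val_pi; split=> [-> //|E].
by apply: val_Mo_inj; rewrite E.
Qed.

Lemma pi_surj x : exists y, pi y = x.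
Proof.
have [y Hy] : exists y, sval (pi y) = sval x; last by exists y; apply: val_Mo_inj.
apply: (svalP x (fun z => exists y, sval (pi y) = z)).
- move=> z Hz; have : exists i m, good i m /\ z = qc (fb 1 i (triv m)).
    case: Hz => [[g [n [H ->]]]|[a [n [/limitbP H ->]]]]; rewrite ebaseE.
      exists (fidx0 g), n; split=> //.
      by rewrite /good /=; apply/orP; right; apply/boolp.asboolP.
    by exists (fidx0 a), n; split=> //; apply: good_limit.
  case=> i [m [g ->]]; exists (fb 1 i (triv m)).
  by rewrite val_pi projU /psrc /= addn0 g.
- by exists 0; rewrite (free_hom0 (HE := HMo) pi_is_hom).
- move=> a b [y <-] [z <-]; exists (y + z).
  by rewrite (free_homD (HE := HMo) pi_is_hom).
- move=> a [y <-]; exists (- y).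
  by rewrite (free_homN (HE := HMo) pi_is_hom).
- move=> a r [y <-]; exists (@mact K F y r).
  by rewrite pi_is_hom.2.
Qed.

(** The ladder is special: [zeta a n] has type [n], so the successor term of the relation is also a
    good generator. *)
Lemma proj_Ggen a n : limitb a -> proj (Ggen K zeta a n) = Ggen K zeta a n.
Proof.
move=> la; rewrite GgenE.
rewrite (endoD proj_is_hom) (endoB proj_is_hom).
rewrite !projU !(good_limit _ la).
by have -> : good (fidx0 (zeta a n)) (psrc (triv n)) by rewrite /psrc addn0; apply: good_zeta.
Qed.

Lemma psi_Ggen a n : limitb a -> psi (fb 1 (fidx0 a) (triv n)) = Ggen K zeta a n.
Proof.
by move=> la; rewrite psiU good_limit //= la GgenE /psrc /= addn0.
Qed.

Lemma Isub_psi x : Isub zeta x -> exists l, x = psi l.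
Proof.
move=> Ix; apply: (Ix (fun x : FZ => exists l, x = psi l)).
- move=> y [a [n [/limitbP la ->]]].
  by exists (fb 1 (fidx0 a) (triv n)); rewrite psi_Ggen.
- by exists 0; rewrite (endo0 psi_is_hom).
- move=> a b [y ->] [z ->]; exists (y + z).
  by rewrite (endoD psi_is_hom).
- move=> a [y ->]; exists (- y).
  by rewrite (endoN psi_is_hom).
- move=> a r [y ->]; exists (@mact K F y r).
  by rewrite psi_is_hom.2.
Qed.

Lemma pi_psi l : pi (psi l) = 0.
Proof.
apply/pi_eq0; elim/free_ind: l => [c i p|x y IHx IHy|].
- rewrite /psi free_endoU proj_is_hom.2.
  apply: (@genA K F); case g: (good i _) => /=; last first.
    rewrite projU /psrc /= addn0 g; exact: (@gen0 K F).
  case l: (limitb _); last first.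
    rewrite (endo0 proj_is_hom); exact: (@gen0 K F).
  rewrite proj_Ggen // => S HS _ _ _ _; apply: HS.
  by exists (val i).1, (psrc p); split=> //; apply/limitbP.
- rewrite (endoD psi_is_hom) (endoD proj_is_hom).
  exact: (@genD K F).
- rewrite (endo0 psi_is_hom) (endo0 proj_is_hom).
  exact: (@gen0 K F).
Qed.

Lemma psi_proj_compl x : psi (x - proj x) = x - proj x.
Proof.
have hq : @is_hom K F F (fun x : FZ => x - proj x).
  by apply: (is_hom_sub (HM := HF) (HN := HF)); [exact: is_hom_id | exact: proj_is_hom].
apply: (free_hom_eq HF (is_hom_comp hq psi_is_hom) hq) => i m.
rewrite projU; case g: (good i _).
  by rewrite subrr (endo0 psi_is_hom).
by rewrite subr0 psiU g.
Qed.

(** If [pi x = 0], then [proj x] lies in [Isub], hence is some [psi l], and [psi] fixes the rest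
    [x - proj x]. *)
Lemma ker_pi x : pi x = 0 <-> exists l, x = psi l.
Proof.
split=> [/pi_eq0 /Isub_psi [l E]|[l ->]]; last exact: pi_psi.
exists (l + (x - proj x)).
by rewrite (endoD psi_is_hom) -E psi_proj_compl addrC subrK.
Qed.

Local Notation HKQ := (KQreg_is_rmodule K).

Lemma psi_extension : @UP disp W -> (exists f : KQ K -> nat, injective f) ->
  forall h : F -> KQreg K, is_hom h -> (forall x, h (rho x) = h x) ->
  exists H : F -> KQreg K, is_hom H /\ forall x, H (psi x) = h x.
Proof.
move=> up [code code_inj] h hh hrho.
pose dd a n : zcar HKQ := h (fb 1 (fidx0 a) (triv n)).
have h_triv i m : zact (h (fb 1 i (triv m)) : zcar HKQ) << triv m >> = h (fb 1 i (triv m)).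
  have [_ hA] := hh; rewrite /zact -hA free_actUU ?mulr1 //=.
  by rewrite /psrc /= addn0.
have [f Hf] : exists f : W -> zcar HKQ, forall a, is_limit a ->
    exists N, forall n, (N <= n)%N -> f (zeta a n) = dd a n.
  (* Every set of colours is the whole of [KQ]; the colour of [zeta a n] is the value of [h] on the
     [n]-th generator at [a]. *)
  apply: (up _ (fun _ _ => True)) => [b||//]; last by case: special.
  by exists code => x y _ _; apply: code_inj.
have exN a : exists N, is_limit a ->
    forall n, (N <= n)%N -> f (zeta a n) = dd a n.
  by case: (limitbP a) => [/Hf[N HN]|nl]; [exists N | exists 0%N].
have [N HN] := boolp.choice exN.
(* Closed form of the downward recursion: [(n, k - n)] is the path [a_(k-1) ... a_n] from [k] to
   [n]. The sum is empty for [n >= N a]. *)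
pose Y a n : zcar HKQ :=
  \sum_(n <= k < N a) zact (f (zeta a k) - dd a k) << (n, (k - n)%N) >>.
have YS a n : is_limit a ->
    Y a n = zact (f (zeta a n)) << triv n >> - dd a n + zact (Y a n.+1) << arrow n >>.
  move=> la; have dE : dd a n = zact (dd a n) << triv n >> by rewrite /dd h_triv.
  rewrite dE -zactBl.
  have [nN|nN] := ltnP n (N a); last first.
    by rewrite HN // subrr zact0l add0r /Y !big_geq ?zact0l ?(leq_trans nN).
  rewrite /Y big_ltn // subnn; congr (_ + _).
  rewrite zact_suml; apply: eq_big_nat => k /andP[nk _].
  rewrite zactA KQmulE pactUUcat ?mulr1 /pcat /=; last by rewrite /psrc addn1.
  by rewrite addn1 subnSK.
pose e i m : zcar HKQ := if ~~ good i m then h (fb 1 i (triv m))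
  else if limitb (val i).1 then Y (val i).1 m else f (val i).1.
have hH := free_ext_is_hom e.
exists (free_ext e); split=> //.
apply: (free_hom_eq HKQ (is_hom_comp psi_is_hom hH) hh) => i m.
have sm : psrc (triv m) = m by rewrite /psrc /= addn0.
rewrite psiU sm; case g: (good i m) => /=; last first.
  by rewrite free_extU sm /e g h_triv.
case l: (limitb _); last first.
  (* [psi] vanishes on a good successor generator, and so does [h] because [rho] kills it. *)
  rewrite -hrho rhoU sm g l /=.
  by rewrite (free_hom0 (HE := HKQ) hH) (free_hom0 (HE := HKQ) hh).
rewrite (free_homD (HE := HKQ) hH) (free_homB (HE := HKQ) hH) !free_extU sm.
have -> : psrc (m, 1%N) = m.+1 by rewrite /psrc addn1.
have [a ei] : exists a, i = fidx0 a by exists (val i).1; exact: good_idx0 g.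
move: g l; rewrite ei /= => g l.
rewrite /e (good_zeta m l) !(good_limit _ l) /= l (negbTE (zeta_not_limit m l)).
have la : is_limit a by exact/limitbP.
(* [free_ext] multiplies by [triv m], which leaves [Y a m] unchanged because its paths end at
   [m]. *)
have Ye : zact (Y a m) << triv m >> = Y a m.
  rewrite [RHS]YS // [in LHS]YS // zactDl zactBl !zactA h_triv.
  rewrite KQmulE !pactUUcat ?mulr1 ?sm //.
have G : zact (f (zeta a m)) << triv m >> - zact (Y a m) << triv m >>
    + zact (Y a m.+1) << arrow m >> = dd a m.
  by rewrite Ye [Y _ m]YS // opprD addrA subrK opprB addrC subrK.
exact: G.
Qed.
End Momega.

(** * Bounds and closure points in the first uncountable ordinal *)

Section Omega1Bounds.
Local Open Scope order_scope.
Variables (disp : Order.disp_t) (W : orderType disp).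
Hypothesis omega1 : @is_omega1 disp W.

Lemma omega1_bound (f : nat -> W) : exists b, forall n, f n < b.
Proof.
have [_ uncountable seg] := omega1.
apply: boolp.contrapT => nb; apply: uncountable.
have cover x : exists n, x <= f n.
  apply: boolp.contrapT => nx; apply: nb; exists x => n.
  by rewrite ltNge; apply/negP => xn; apply: nx; exists n.
have [N HN] := boolp.choice cover.
have [g Hg] := boolp.choice seg.
(* Code [x] by an [n] with [x <= f n] and its number in the segment below [f n]; [0] is reserved for
   [f n], which the strict segment misses. *)
exists (fun x => choice.pickle (N x, if x == f (N x) then 0%N else (g (f (N x)) x).+1)).
move=> x y /(pcan_inj choice.pickleK) [eN]; rewrite -eN.
have := HN x; have := HN y; rewrite -eN !le_eqVlt.
have [ey|_] := eqVneq y (f (N x)); have [ex|_] //= := eqVneq x (f (N x)).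
  by move=> _ _ _; rewrite ex.
by move=> yN xN [] /Hg; apply.
Qed.

(** The segment is countable, so [B] on it is a sequence; indices that code no point get an
    arbitrary value. *)
Lemma omega1_bound_segment (B : W -> W) a : exists b, forall x, x < a -> B x < b.
Proof.
have [_ _ /(_ a) [g Hg]] := omega1.
have ex n : exists y, forall x, x < a -> g x = n -> y = B x.
  case: (boolp.pselect (exists2 x, x < a & g x = n)) => [[x xa gx]|nx].
    by exists (B x) => x' xa' gx'; rewrite (Hg x x') // gx.
  by exists (B a) => x xa gx; case: nx; exists x.
have [h Hh] := boolp.choice ex; have [b Hb] := omega1_bound h.
by exists b => x xa; rewrite -(Hh (g x) x).
Qed.

(** Iterate a step that passes the current point and all values of [B] below it; the least strict
    upper bound of the iterates is the limit sought. *)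
Lemma omega1_closed_limit (B : W -> W) :
  exists d, is_limit d /\ forall x, x < d -> B x < d.
Proof.
have [wf uncountable _] := omega1.
have [w _] : exists w : W, True.
  apply: boolp.contrapT => nw; apply: uncountable.
  by exists (fun _ => 0%N) => x; case: nw; exists x.
have step a : exists b, a < b /\ forall x, x < a -> B x < b.
  have [b Hb] := omega1_bound_segment B a; have [c Hc] := omega1_bound (fun=> Order.max a b).
  exists c; have := Hc 0%N; rewrite gt_max => /andP[ac bc]; split=> // x /Hb xb.
  exact: lt_trans xb bc.
have [s Hs] := boolp.choice step; pose u k := iter k s w.
have [d [du dmin]] := wf (fun x => forall k, u k < x) (omega1_bound u).
have below x : x < d -> exists k, x <= u k.
  move=> xd; apply: boolp.contrapT => nx; have := dmin x.
  rewrite leNgt xd => H; suff: false by []; apply: H => k.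
  by rewrite ltNge; apply/negP => xk; apply: nx; exists k.
exists d; split; last first.
  (* The step controls [B] on strict segments only: [x <= u k < u k.+1] gives [B x < u k.+2]. *)
  move=> x /below [k xk]; apply: lt_trans (du k.+2).
  by apply: (Hs (u k.+1)).2; apply: le_lt_trans xk (Hs (u k)).1.
split=> [/(_ (u 0%N))|[b [bd bmin]]]; first by rewrite leNgt du.
have [k bk] := below b bd.
have := bmin (u k.+1) (le_lt_trans bk (Hs (u k)).1).
by rewrite leNgt du.
Qed.
End Omega1Bounds.

(** * Failure of projectivity *)

Section NonProjective.
Variables (K : fieldType) (disp : Order.disp_t) (W : orderType disp).
Variable zeta : W -> nat -> W.
Hypothesis special : special_ladder zeta.
Hypothesis omega1 : @is_omega1 disp W.

Local Notation fidx := (@Fidx disp W).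
Local Notation F := (Fmod K W).
Local Notation HF := (@free_mod_is_rmodule K fidx).
Local Notation FZ := {malg K[(fidx * path)%type]}.

(** Concatenation adds lengths. This turns divisibility by arbitrarily long paths into vanishing. *)
Lemma act_long_path (z : FZ) t l i p : (p.2 < l)%N ->
  (@mact K F z << (t, l) >> : FZ)@_(i, p) = 0.
Proof.
move=> pl; elim/free_ind: z => [c j q|x y IHx IHy|].
- have [qt|qt] := eqVneq (ptgt q) (psrc (t, l)).
    rewrite [mact _ _](free_actUU c j 1 qt) fbE mcoeffU; case: eqP => // -[_ e].
    by move: pl; rewrite -e /= ltnNge leq_addl.
  by rewrite fbE [mact _ _]pactUU0 // mcoeff0.
- rewrite [mact _ _]free_actDl [LHS]mcoeffD.
  exact: etrans (f_equal2 +%R IHx IHy) (addr0 _).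
- by rewrite [mact _ _]free_act0l mcoeff0.
Qed.

Section Truncation.
Variable d : W.
Hypothesis limit_d : limitb d.

(** The quotient of [F] by the part below [d], realized as the projection onto the complementary
    summand. *)
Definition trunc : FZ -> FZ :=
  free_endo (fun i m => if ((val i).1 < d)%O then 0 else fb 1 i (triv m)).

Lemma trunc_is_hom : @is_hom K F F trunc.
Proof. exact: free_endo_is_hom. Qed.

Lemma truncU c i p : trunc (fb c i p) = if ((val i).1 < d)%O then 0 else fb c i p.
Proof.
rewrite /trunc free_endoU; case: (_ < d)%O; first exact: free_act0l.
by rewrite [RHS]free_gen.
Qed.

Lemma trunc_eq0 (x : FZ) : (forall k, k \in msupp x -> ((val k.1).1 < d)%O) -> trunc x = 0.
Proof.
move=> H; rewrite [x]monalgE (big_morph _ (endoD trunc_is_hom) (endo0 trunc_is_hom)).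
rewrite big_seq big1 // => -[i p] kx.
by rewrite -fbE truncU (H (i, p)).
Qed.

Definition mass : FZ -> K^o := locked_with fb_key
  (lext (fun k : fidx * path => (k.1 == fidx0 d)%:R : K^o)).

Lemma massU c i p : mass (fb c i p) = c * (i == fidx0 d)%:R.
Proof. by rewrite /mass unlock lext_fb. Qed.

Lemma massD : {morph mass : x y / x + y}.
Proof. by rewrite /mass unlock; exact: lextD. Qed.
Lemma massN : {morph mass : x / - x}.
Proof. by rewrite /mass unlock; exact: lextN. Qed.
Lemma mass0 : mass 0 = 0.
Proof. by rewrite /mass unlock lext0. Qed.

Lemma mass_trunc x : mass (trunc x) = mass x.
Proof.
elim/free_ind: x => [c i p|x y IHx IHy|].
- rewrite truncU; case id: (_ < d)%O => //; rewrite mass0 massU.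
  by case: eqP id => [->|_ _]; rewrite ?mulr0 //= ltxx.
- by rewrite (endoD trunc_is_hom) !massD IHx IHy.
- by rewrite (endo0 trunc_is_hom).
Qed.

(** Once paths are forgotten, the two terms at the limit cancel; the third sits at a successor,
    hence not at [d]. Generators fixed by [psi] are not good, so they are not at [fidx0 d]
    either. *)
Lemma mass_psi x : mass (psi zeta x) = 0.
Proof.
elim/free_ind: x => [c i p|x y IHx IHy|].
- rewrite psiU //; case g: (good i (psrc p)) => /=; last first.
    rewrite massU; case: eqP g => [->|_ _]; last by rewrite mulr0.
    by rewrite good_limit.
  case l: (limitb _); last exact: mass0.
  rewrite massD massD massN !massU subrK.
  case: eqP => [/(congr1 val) [e]|_]; last by rewrite mulr0.
  by have := zeta_not_limit special (psrc p) l; rewrite e limit_d.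
- by rewrite (endoD (psi_is_hom K zeta)) massD IHx IHy addr0.
- by rewrite (endo0 (psi_is_hom K zeta)) mass0.
Qed.
End Truncation.

Lemma Momega1_not_projective : ~ projective (Momega1 K zeta).
Proof.
move=> PM; have [s [hs pis]] := PM F (@pi K _ _ zeta) HF (pi_is_hom K zeta) (@pi_surj K _ _ zeta).
pose phi (x : FZ) : FZ := s (pi zeta x).
have hphi : @is_hom K F F phi by exact: is_hom_comp (pi_is_hom K zeta) hs.
have phi_psi x : phi (psi zeta x) = 0.
  rewrite /phi pi_psi //; exact: (hom0 (HM := Momega1_is_rmodule K zeta) (HN := HF) hs).
have bnd xi : exists b, forall m k, k \in msupp (phi (fb 1 (fidx0 xi) (triv m))) ->
    ((val k.1).1 < b)%O.
  pose sm m : seq W := [seq (val k.1).1 | k <- enum_fset (msupp (phi (fb 1 (fidx0 xi) (triv m))))].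
  (* Over all vertices the supports form a countable union of finite sets, enumerated by pairs of a
     vertex and a position; [xi] is a filler. *)
  have [b Hb] := omega1_bound omega1 (fun n => if choice.unpickle n is Some (m, j) then nth xi (sm m) j else xi).
  exists b => m k km; have := Hb (choice.pickle (m, index (val k.1).1 (sm m))).
  by rewrite choice.pickleK nth_index //; apply: (map_f (fun k => (val k.1).1)).
have [B HB] := boolp.choice bnd.
have [d [/limitbP ld dB]] := omega1_closed_limit omega1 B.
pose T x := trunc d (phi x).
have hT : @is_hom K F F T by exact: is_hom_comp hphi (trunc_is_hom d).
have T_low xi p : (xi < d)%O -> T (fb 1 (fidx0 xi) p) = 0.
  move=> xd; rewrite free_gen [LHS](hT.2); suff -> : T (fb 1 (fidx0 xi) (triv (psrc p))) = 0.
    exact: free_act0l.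
  by apply: trunc_eq0 => k /HB kB; apply: lt_trans kB (dB _ xd).
(* This is [e^d_l] times the path from [l] to [0]. The relation at [d] links [y l] and [y l.+1] up
   to a term at a ladder point below [d], which [T] kills. *)
pose y l : FZ := fb 1 (fidx0 d) (0%N, l).
have Ty l : T (y 0%N) = T (y l).
  elim: l => // l ->; have := phi_psi (y l).
  rewrite psiU // good_limit //= ld => /(congr1 (trunc d)).
  rewrite (endo0 (trunc_is_hom d)) -/(T _) (endoD hT) (endoB hT).
  rewrite T_low ?add0r; last by have [H _] := special; have [_ + _] := H d (limitbP _ ld); apply.
  by move=> /eqP; rewrite addrC subr_eq0 => /eqP ->.
have T0 : T (y 0%N) = 0.
  (* For the coefficient at [p], take [l] one more than the length of [p]. *)
  apply/malgP => -[i p]; rewrite mcoeff0 (Ty p.2.+1) /y free_gen.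
  by rewrite [T _]hT.2 act_long_path.
have /(ker_pi special) [l El] : pi zeta (phi (y 0%N) - y 0%N) = 0.
  rewrite (free_homB (HE := Momega1_is_rmodule K zeta) (pi_is_hom K zeta)).
  by rewrite /phi pis subrr.
(* The mass is zero by [mass_psi], yet it is [0 - 1] because truncation preserves mass. *)
have := mass_psi ld l; rewrite -El massD massN massU -(mass_trunc d (phi _)).
rewrite -/(T _) T0 mass0 add0r eqxx mulr1 => /eqP.
by rewrite oppr_eq0 oner_eq0.
Qed.
End NonProjective.

(** * Countability of the path algebra, and the two assertions of the theorem *)

Lemma KQ_countable (K : countFieldType) : exists f : KQ K -> nat, injective f.
Proof.
exists (fun x => choice.pickle [seq (p, x@_p) | p <- enum_fset (msupp x)]).
move=> x y /(pcan_inj choice.pickleK) E; apply/malgP => p.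
have supp z q : ((q, z@_q) \in [seq (p, z@_p) | p <- enum_fset (@msupp path K z)]) = (q \in msupp z).
  by apply/mapP/idP => [[r rz [-> _]] //|qz]; exists q.
case: (boolP (p \in msupp x)) => px.
  have : (p, x@_p) \in [seq (p, y@_p) | p <- enum_fset (msupp y)] by rewrite -E supp.
  by case/mapP => q _ [-> ->].
case: (boolP (p \in msupp y)) => py; last by rewrite !mcoeff_outdom.
have : (p, y@_p) \in [seq (p, x@_p) | p <- enum_fset (msupp x)] by rewrite E supp.
by case/mapP => q _ [-> ->].
Qed.

Theorem theorem2p4 (K : countClosedFieldType) (disp : Order.disp_t)
  (W : orderType disp) (zeta : W -> nat -> W) :
  @is_omega1 disp W -> special_ladder zeta -> @UP disp W ->
  Ext_zero 1 (Momega1 K zeta) (KQreg K) /\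
  ~ (forall M : rmodule K, is_rmodule M ->
       (forall n, (1 <= n)%N -> Ext_zero n M (KQreg K)) -> projective M).
Proof.
move=> omega1 special up.
pose HM := Momega1_is_rmodule K zeta.
pose HF := @free_mod_is_rmodule K (@Fidx disp W).
have ext1 : Ext_zero 1 (Momega1 K zeta) (KQreg K).
  move=> P d eps resP f; apply: (presentation_Ext1 (HM := HM) (HF := HF)
    (KQreg_is_rmodule K)    (@free_lifting K (@Fidx disp W)) (pi_is_hom K zeta) (psi_is_hom K zeta)
    (rho_is_hom K W) (@pi_surj K _ _ zeta) (ker_pi special) (psi_rho zeta)
    (sigma_psi special) resP).
  move=> h hh hr; exact: (psi_extension special up (KQ_countable K) hh hr).
split=> // H; apply: (@Momega1_not_projective K _ _ zeta special omega1).
(* Degree [1] is [ext1]; from degree [2] on, projective dimension at most one suffices. *)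
apply: H => // -[|[|n]] // _ P d eps resP f.
exact: (presentation_Ext_ge2 (HM := HM) (HF := HF)
    (KQreg_is_rmodule K)    (@free_lifting K (@Fidx disp W)) (pi_is_hom K zeta) (psi_is_hom K zeta)
    (rho_is_hom K W) (@pi_surj K _ _ zeta) (ker_pi special) (psi_rho zeta)
    (sigma_psi special) resP).
Qed.
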